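(* Let $\mathbb{X}$ be a real Banach space such that $\operatorname{Sm}\mathbb{X}$ is a dense $G_\delta$ subset of $\mathbb{X}$, and let $T:\mathbb{X}\to\mathbb{X}$ be a non-zero bounded linear operator. The following are equivalent: (i) $T$ preserves Birkhoff–James orthogonality at each point of $\operatorname{Sm}\mathbb{X}$; (ii) $T$ preserves Birkhoff–James orthogonality at each point of some dense subset $U$ of $\mathbb{X}$; (iii) $T$ preserves Birkhoff–James orthogonality at each point of some hyperplane $H$ not passing through the origin; (iv) $T$ preserves $\rho_+$-orthogonality at each point of $\operatorname{Sm}\mathbb{X}$; (v) $T$ preserves $\rho_-$-orthogonality at each point of $\operatorname{Sm}\mathbb{X}$; (vi) $T$ preserves $\rho$-orthogonality at each point of $\operatorname{Sm}\mathbb{X}$; (vii) $T$ is a scalar multiple of an isometry.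
   Context: $u\perp_B v$ means $\|u+\lambda v\|\ge\|u\|$ for all real $\lambda$; $T$ preserves Birkhoff–James orthogonality at $x$ if $x\perp_B v\Rightarrow Tx\perp_B Tv$ for all $v$. Norm derivatives: $\rho'_\pm(u,v)=\|u\|\lim_{t\to0^\pm}\frac{\|u+tv\|-\|u\|}{t}$ and $\rho'(u,v)=\frac12(\rho'_+(u,v)+\rho'_-(u,v))$. $u\perp_{\rho_\pm}v$ iff $\rho'_\pm(u,v)=0$, and $u\perp_\rho v$ iff $\rho'(u,v)=0$. $T$ preserves $\rho_\pm$- (resp. $\rho$-) orthogonality at $x$ if $x\perp_{\rho_\pm}v\Rightarrow Tx\perp_{\rho_\pm}Tv$ (resp. with $\rho$) for all $v$. For non-zero $z$, $J(z)=\{f\in\mathbb{X}^*:\|f\|=1,\ f(z)=\|z\|\}$; $z$ is smooth if $J(z)$ is a singleton; $\operatorname{Sm}\mathbb{X}$ is the set of smooth points. A hyperplane not passing through the origin is $\{x:\varphi(x)=c\}$ with $\varphi$ a non-zero bounded linear functional and $c\ne0$. Scalar multiple of an isometry: $\|Tx\|=\lambda\|x\|$ for all $x$, for a constant $\lambda$. *)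

(* Defs.v *)
From HB Require Import structures.
From mathcomp Require Import all_boot all_order all_algebra.
From mathcomp Require Import all_classical all_reals all_analysis.
Set Implicit Arguments. Unset Strict Implicit. Unset Printing Implicit Defensive.
Import Order.TTheory GRing.Theory Num.Theory.
Import numFieldNormedType.Exports.
Local Open Scope classical_set_scope.
Local Open Scope ring_scope.

Section BJDefs.
Context {R : realType} {X : normedModType R}.

Definition BJ_orth (u v : X) : Prop := forall l : R, `|u| <= `|u + l *: v|.

Definition rho_plus (u v : X) : R :=
  `|u| * lim ((fun t : R => (`|u + t *: v| - `|u|) / t) t @[t --> 0^'+]).
Definition rho_minus (u v : X) : R :=
  `|u| * lim ((fun t : R => (`|u + t *: v| - `|u|) / t) t @[t --> 0^'-]).
Definition rho (u v : X) : R := (rho_plus u v + rho_minus u v) / 2.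

Definition rho_plus_orth (u v : X) : Prop := rho_plus u v = 0.
Definition rho_minus_orth (u v : X) : Prop := rho_minus u v = 0.
Definition rho_orth (u v : X) : Prop := rho u v = 0.

Definition lin_functional (f : X -> R) : Prop :=
  forall (a : R) (x y : X), f (a *: x + y) = a * f x + f y.
Definition dual_elt (f : X -> R) : Prop := lin_functional f /\ continuous f.

Definition fnorm (f : X -> R) : R := sup [set `|f x| | x in [set x : X | `|x| <= 1]].

Definition Jset (z : X) : set (X -> R) :=
  [set f | dual_elt f /\ fnorm f = 1 /\ f z = `|z|].

Definition smooth_pt (z : X) : Prop :=
  z != 0 /\ exists f, Jset z f /\ forall g, Jset z g -> g = f.
Definition SmX : set X := [set z | smooth_pt z].

Definition G_delta (S : set X) : Prop :=
  exists F : nat -> set X, (forall n, open (F n)) /\ S = \bigcap_n F n.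

Definition affine_hyperplane (H : set X) : Prop :=
  exists (phi : X -> R) (c : R),
    dual_elt phi /\ (exists x, phi x != 0) /\ c != 0 /\ H = [set x | phi x = c].

Definition preserves_at (orth : X -> X -> Prop) (T : X -> X) (x : X) : Prop :=
  forall v, orth x v -> orth (T x) (T v).

Definition scalar_mult_isometry (T : X -> X) : Prop :=
  exists l : R, forall x, `|T x| = l * `|x|.

End BJDefs.

(* Main.v *)
Require Import Defs.
From HB Require Import structures.
From mathcomp Require Import all_boot all_order all_algebra.
From mathcomp Require Import all_classical all_reals all_analysis.
From mathcomp Require Import ring lra.
Import Order.TTheory GRing.Theory Num.Theory.
Import numFieldNormedType.Exports.
Local Open Scope classical_set_scope.
Local Open Scope ring_scope.

(** At a non-zero x with support functional f, all the orthogonality hypotheses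
    give T x _|_B T v for every v in ker f: the norm derivatives at a smooth point
    are |x| f by Hahn-Banach, and a vanishing norm derivative at T x forces
    Birkhoff-James orthogonality by convexity.  Splitting y along x and ker f this
    reads |T x| f(y) <= |T y| |x|, so that |T .| and |.| share, up to the ratio
    r = |T .| / |.|, the support functional f at x.

    Such x are dense, and this forces r to be constant.  Choose points z_i of this
    kind close to a fine equal subdivision of a segment [x, y] avoiding 0, with
    support functionals f_i.  Then r(z_i) - r(z_(i+1)) is at most a constant times
    |z_(i+1)| - f_i z_(i+1) <= (f_(i+1) - f_i)(z_(i+1) - z_i), and as
    z_(i+1) - z_i is nearly (y - x) / n, the sum of these bounds telescopes to
    O(1/n).  Hence r x <= r y for all non-zero x and y.

    For a hyperplane phi = c, homogeneity spreads the hypothesis to the dense set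
    phi <> 0. *)

(** * Sublinear functionals and the Hahn-Banach theorem *)

Section Sublinear.
Context {R : realType} {X : lmodType R}.
Implicit Types (p q : X -> R) (x y v : X).

Definition sublinear p : Prop :=
  (forall x y, p (x + y) <= p x + p y) /\
  (forall (a : R) x, 0 <= a -> p (a *: x) = a * p x).

(** Inverting a positive scalar gives the reverse inequality; the factors 2 and 1/2 at the origin
    force [p 0 = 0], which settles [a = 0]. *)
Lemma sublinear_of_pos_le p :
  (forall x y, p (x + y) <= p x + p y) ->
  (forall (a : R) x, 0 < a -> p (a *: x) <= a * p x) -> sublinear p.
Proof.
move=> pD pZ; split=> // a x; rewrite le_eqVlt => /orP[/eqP <-|a0].
  rewrite scale0r mul0r.
  have := pZ 2 0; have := pZ 2^-1 0; rewrite !scaler0 => h1 h2.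
  have : p 0 <= 2^-1 * p 0 by apply: h1; lra.
  have : p 0 <= 2 * p 0 by apply: h2; lra.
  lra.
apply/eqP; rewrite eq_le pZ//=.
have := pZ a^-1 (a *: x); rewrite scalerA mulVf ?gt_eqF// scale1r invr_gt0 => /(_ a0).
by rewrite ler_pdivlMl.
Qed.

Lemma sublinear0 p : sublinear p -> p 0 = 0.
Proof. by case=> _ pZ; rewrite -(scale0r (0 : X)) pZ// mul0r. Qed.

Lemma sublinear_geN p x : sublinear p -> - p (- x) <= p x.
Proof.
move=> sp; have := sp.1 x (- x); rewrite subrr sublinear0//; lra.
Qed.

(** For sublinear [p], this is the largest sublinear functional below [p] whose value at [- v] is at
    most [- p v]. *)
Definition descent p v y : R :=
  inf [set p (y + t *: v) - t * p v | t in [set t : R | 0 <= t]].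

Lemma descent_le p v y (t : R) : sublinear p -> 0 <= t ->
  descent p v y <= p (y + t *: v) - t * p v.
Proof.
move=> sp t0; apply: ge_inf; last by exists t.
(* Subadditivity bounds the family below, so the infimum is genuine. *)
exists (- p (- y)) => _ [s /= s0 <-].
have := sp.1 (- y) (y + s *: v); rewrite addKr sp.2//; lra.
Qed.

Lemma descent_ge p v y (m : R) :
  (forall t : R, 0 <= t -> m <= p (y + t *: v) - t * p v) -> m <= descent p v y.
Proof.
move=> h; apply: lb_le_inf => [|_ [t t0 <-]]; last exact: h.
by exists (p (y + 0 *: v) - 0 * p v); exists 0 => //=.
Qed.

(** Parameters [s] for [x] and [t] for [y] combine to [s + t] for [x + y]; scaling by [a] turns [t]
    into [a * t]. *)
Lemma descent_sublinear p v : sublinear p -> sublinear (descent p v).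
Proof.
move=> sp; apply: sublinear_of_pos_le => [x y|a x a0].
  rewrite -lerBlDr; apply: descent_ge => s s0.
  rewrite lerBlDr -lerBlDl; apply: descent_ge => t t0.
  have := @descent_le p v (x + y) (s + t) sp (addr_ge0 s0 t0).
  have := sp.1 (x + s *: v) (y + t *: v).
  rewrite addrACA -scalerDl; lra.
rewrite -ler_pdivrMl//; apply: descent_ge => t t0; rewrite ler_pdivrMl//.
have := @descent_le p v (a *: x) (a * t) sp (mulr_ge0 (ltW a0) t0).
by rewrite -scalerA -scalerDr sp.2 ?(ltW a0)// -mulrA -mulrBr.
Qed.

Lemma descent_le_self p v y : sublinear p -> descent p v y <= p y.
Proof.
by move=> sp; have := @descent_le p v y 0 sp (lexx _); rewrite scale0r addr0 mul0r subr0.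
Qed.

Lemma descentN p v : sublinear p -> descent p v (- v) <= - p v.
Proof.
move=> sp; have := @descent_le p v (- v) 1 sp ler01.
by rewrite scale1r addNr sublinear0// mul1r sub0r.
Qed.

Lemma exists_minimal_sublinear p : sublinear p ->
  exists f, [/\ sublinear f, (forall x, f x <= p x) &
    forall q, sublinear q -> (forall x, q x <= f x) -> q = f].
Proof.
move=> sp.
pose T0 := {q : X -> R | sublinear q /\ forall x, q x <= p x}.
(* The order is reversed, so a maximal element from Zorn is a minimal functional. *)
pose below (q1 q2 : T0) := `[< forall x, sval q2 x <= sval q1 x >].
have [||||[f [sf fp]] fmin] := @Zorn T0 below.
- by move=> q; apply/asboolP.
- move=> q1 q2 q3 /asboolP h1 /asboolP h2; apply/asboolP => x.
  exact: le_trans (h2 x) (h1 x).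
- move=> [q1 h1] [q2 h2] /asboolP /= h /asboolP /= h'.
  apply: eq_exist; apply/funext => x; apply/eqP; by rewrite eq_le h h'.
- move=> A Atot; have [[q0 Aq0]|A0] := pselect (exists q : T0, A q); last first.
    by exists (exist _ p (conj sp (fun x => lexx (p x)))) => s As; case: A0; exists s.
  pose m x := inf [set sval (q : T0) x | q in A].
  have m_le (q : T0) x : A q -> m x <= sval q x.
    move=> Aq; apply: ge_inf; last by exists q.
    exists (- p (- x)) => _ [[q1 [sq1 q1p]] _ <-] /=.
    by apply: le_trans (sublinear_geN _ x sq1); rewrite lerN2.
  have m_ge x (c : R) : (forall q : T0, A q -> c <= sval q x) -> c <= m x.
    move=> h; apply: lb_le_inf => [|_ [q Aq <-]]; last exact: h.
    by exists (sval q0 x), q0.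
  have sm : sublinear m.
    apply: sublinear_of_pos_le => [x y|a x a0].
      rewrite -lerBlDr; apply: (m_ge) => q1 A1.
      rewrite lerBlDr -lerBlDl; apply: (m_ge) => q2 A2.
      (* The smaller of the two comparable functionals serves for both [x] and [y]. *)
      have [/asboolP h|/asboolP h] := Atot _ _ A1 A2.
        have := m_le _ (x + y) A2; have := (svalP q2).1.1 x y; have := h x; lra.
      have := m_le _ (x + y) A1; have := (svalP q1).1.1 x y; have := h y; lra.
    rewrite -ler_pdivrMl//; apply: (m_ge) => q Aq; rewrite ler_pdivrMl//.
    by have := m_le _ (a *: x) Aq; rewrite (svalP q).1.2// ltW.
  have mp x : m x <= p x by apply: le_trans (m_le _ x Aq0) _; exact: (svalP q0).2.
  by exists (exist _ m (conj sm mp)) => s As; apply/asboolP => x /=; exact: m_le.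
exists f; split=> // q sq qf.
have qp x : q x <= p x by exact: le_trans (qf x) (fp x).
have qq := fmin (exist _ q (conj sq qp) : T0).
by have /(congr1 (@sval _ _)) := qq (asboolT qf).
Qed.

(* A minimal sublinear functional equals its own descent in every direction,
   hence is odd, hence additive. *)
Lemma exists_linear_below p : sublinear p ->
  exists f, scalar f /\ forall x, f x <= p x.
Proof.
move=> /exists_minimal_sublinear[f [sf fp fmin]]; exists f; split=> //.
have fN x : f (- x) = - f x.
  apply/eqP; rewrite eq_le; apply/andP; split; last first.
    by have := sublinear_geN _ (- x) sf; rewrite opprK.
  rewrite -{1}(fmin _ (descent_sublinear _ x sf)); first exact: descentN.
  by move=> y; by apply: descent_le_self.
have fD x y : f (x + y) = f x + f y.
  apply/eqP; rewrite eq_le sf.1/=.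
  by have := sf.1 (- x) (- y); rewrite -opprD !fN; lra.
move=> a x y; rewrite fD; congr (_ + _).
have [a0|a0] := leP 0 a; first exact: sf.2.
by rewrite -[a]opprK scaleNr fN sf.2 ?mulNr// oppr_ge0 ltW.
Qed.

(** A linear functional below [descent p v] is at most [- p v] at [- v], hence at least [p v] at
    [v]. *)
Theorem hahn_banach_touching p v : sublinear p ->
  exists f, [/\ scalar f, (forall x, f x <= p x) & f v = p v].
Proof.
move=> sp; have [f [lf fd]] := exists_linear_below _ (descent_sublinear _ v sp).
have fp x : f x <= p x by apply: le_trans (fd x) (descent_le_self _ _ _ sp).
exists f; split=> //; apply/eqP; rewrite eq_le fp/=.
have := le_trans (fd (- v)) (descentN _ v sp).
by have := lf (-1) v 0; have := lf (-1) 0 0; rewrite !scaleN1r !oppr0 !addr0; lra.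
Qed.

End Sublinear.

(** * One-sided derivatives of the norm and support functionals *)

Section NormDerivative.
Context {R : realType} {X : normedModType R}.
Implicit Types (x y u v w z : X) (f g : X -> R).

Lemma norm_sublinear : sublinear (fun x : X => `|x|).
Proof.
split=> [x y|a x a0]; first exact: ler_normD.
by rewrite normrZ ger0_norm.
Qed.

(* The quotient (|x + s v| - |x|) / s is |v + t x| - t |x| at t = 1 / s, so the
   right derivative of the norm at x is the descent of the norm along x. *)
Definition norm_rderiv x v : R := descent (fun y : X => `|y|) x v.

Lemma norm_rderiv_le_quotient x v (s : R) : 0 < s ->
  norm_rderiv x v <= (`|x + s *: v| - `|x|) / s.
Proof.
move=> s0; have si : 0 <= s^-1 by rewrite invr_ge0 ltW.
apply: le_trans (descent_le _ _ _ _ norm_sublinear si) _.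
rewrite ler_pdivlMr// mulrBl mulrAC mulVf ?gt_eqF// mul1r lerD2r.
rewrite -{2}(ger0_norm (ltW s0)) mulrC -normrZ scalerDr scalerA divff ?gt_eqF//.
by rewrite scale1r addrC.
Qed.

(** If [t] nearly attains the infimum, convexity keeps the quotient equally close to it for every
    positive [s] up to [1 / t]. *)
Lemma cvg_norm_quotient_right x v :
  (`|x + t *: v| - `|x|) / t @[t --> 0^'+] --> norm_rderiv x v.
Proof.
apply/cvgrPdist_le => e e0.
have [t t0 te] : exists2 t : R, 0 < t &
    `|v + t *: x| - t * `|x| < norm_rderiv x v + e.
  apply: contrapT => h; suff : norm_rderiv x v + e <= norm_rderiv x v by lra.
  apply: descent_ge => t t0; rewrite leNgt; apply/negP => ht; apply: h.
  (* Passing to [t + 1] makes the parameter positive and, by the triangle inequality, does not raise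
     the value. *)
  exists (t + 1); first lra.
  apply: le_lt_trans ht; rewrite scalerDl scale1r addrA.
  by have := ler_normD (v + t *: x) x; lra.
have ti : 0 < t^-1 by rewrite invr_gt0.
near=> s.
have s0 : 0 < s by [].
have st : s * t <= 1.
  by rewrite -ler_pdivlMr// mul1r; near: s; exact: nbhs_right_le.
have h1 := norm_rderiv_le_quotient x v _ s0.
rewrite distrC ger0_norm ?subr_ge0// lerBlDl.
apply: le_trans (ltW te); rewrite ler_pdivrMr//.
have -> : x + s *: v = s *: (v + t *: x) + (1 - s * t) *: x.
  by rewrite scalerDr scalerA scalerBl scale1r [RHS]addrC (addrC (s *: v)) addrA subrK.
have := ler_normD (s *: (v + t *: x)) ((1 - s * t) *: x).
rewrite !normrZ (ger0_norm (ltW s0)) (@ger0_norm _ (1 - s * t)) ?subr_ge0//.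
nra.
Unshelve. all: by end_near. Qed.

Lemma cvg_norm_quotient_left x v :
  (`|x + t *: v| - `|x|) / t @[t --> 0^'-] --> - norm_rderiv x (- v).
Proof.
apply/cvg_at_leftNP; rewrite oppr0.
have -> : (fun t : R => (`|x + t *: v| - `|x|) / t) \o -%R =
          (fun t : R => - ((`|x + t *: (- v)| - `|x|) / t)).
  by apply/funext => t /=; rewrite scaleNr scalerN invrN mulrN.
by apply: cvgN; exact: cvg_norm_quotient_right.
Qed.

Lemma rho_plusE x v : rho_plus x v = `|x| * norm_rderiv x v.
Proof. by congr (_ * _); apply/cvg_lim => //; exact: cvg_norm_quotient_right. Qed.

Lemma rho_minusE x v : rho_minus x v = - (`|x| * norm_rderiv x (- v)).
Proof.
by rewrite -mulrN; congr (_ * _); apply/cvg_lim => //; exact: cvg_norm_quotient_left.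
Qed.

Lemma BJ_orth_of_rderiv_ge0 x v :
  0 <= norm_rderiv x v -> 0 <= norm_rderiv x (- v) -> BJ_orth x v.
Proof.
move=> h1 h2 l; have [l0|l0|<-] := ltgtP 0 l; last by rewrite scale0r addr0.
  have := le_trans h1 (norm_rderiv_le_quotient x v _ l0).
  by rewrite pmulr_lge0 ?invr_gt0// subr_ge0.
have l1 : 0 < - l by rewrite oppr_gt0.
have := le_trans h2 (norm_rderiv_le_quotient x (- v) _ l1).
by rewrite pmulr_lge0 ?invr_gt0// subr_ge0 scalerN scaleNr opprK.
Qed.

Lemma norm_rderiv_addN_ge0 x v : 0 <= norm_rderiv x v + norm_rderiv x (- v).
Proof.
have := sublinear_geN _ v (descent_sublinear _ x norm_sublinear).
by rewrite /norm_rderiv; lra.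
Qed.

Lemma BJ_orth0l v : BJ_orth 0 v.
Proof. by move=> l; rewrite normr0. Qed.

Lemma BJ_orth_of_rho_plus u w :
  rho_plus_orth u w -> rho_plus_orth u (- w) -> BJ_orth u w.
Proof.
have [->|u0] := eqVneq u 0; first by move=> _ _; exact: BJ_orth0l.
rewrite /rho_plus_orth !rho_plusE => /eqP; rewrite mulf_eq0 normr_eq0 (negPf u0)/= => /eqP h1.
move=> /eqP; rewrite mulf_eq0 normr_eq0 (negPf u0)/= => /eqP h2.
by apply: BJ_orth_of_rderiv_ge0; rewrite ?h1 ?h2.
Qed.

Lemma rho_plus_orthN u w : rho_plus_orth u (- w) <-> rho_minus_orth u w.
Proof.
rewrite /rho_plus_orth /rho_minus_orth rho_plusE rho_minusE.
by split=> [->|/eqP]; rewrite ?oppr0// oppr_eq0 => /eqP.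
Qed.

(** For non-zero [u] the right derivatives along [w] and [- w] are equal; their sum is non-negative,
    so both are. *)
Lemma BJ_orth_of_rho u w : rho_orth u w -> BJ_orth u w.
Proof.
have [->|u0] := eqVneq u 0; first by move=> _; exact: BJ_orth0l.
rewrite /rho_orth /rho rho_plusE rho_minusE -mulrBr => /eqP.
rewrite mulf_eq0 invr_eq0 pnatr_eq0 orbF mulf_eq0 normr_eq0 (negPf u0)/= => /eqP h.
have := norm_rderiv_addN_ge0 u w => h'.
by apply: BJ_orth_of_rderiv_ge0; lra.
Qed.

(** At a non-zero point this is membership in [Jset], freed of the supremum; the one-sided bound
    already yields continuity. *)
Definition supports x f : Prop :=
  [/\ lin_functional f, forall y, f y <= `|y| & f x = `|x|].

Section Linear.
Variables (f : X -> R) (lf : lin_functional f).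

Lemma lin_functional0 : f 0 = 0.
Proof. by have := lf 1 0 0; rewrite scaler0 addr0 mul1r; lra. Qed.

Lemma lin_functionalD x y : f (x + y) = f x + f y.
Proof. by have := lf 1 x y; rewrite scale1r mul1r. Qed.

Lemma lin_functionalZ (a : R) x : f (a *: x) = a * f x.
Proof. by have := lf a x 0; rewrite !addr0 lin_functional0 addr0. Qed.

Lemma lin_functionalN x : f (- x) = - f x.
Proof. by rewrite -scaleN1r lin_functionalZ mulN1r. Qed.

Lemma lin_functionalB x y : f (x - y) = f x - f y.
Proof. by rewrite lin_functionalD lin_functionalN. Qed.

Lemma lin_functional_norm_le : (forall y, f y <= `|y|) -> forall y, `|f y| <= `|y|.
Proof.
move=> fle y; rewrite ler_norml fle andbT lerNl -lin_functionalN.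
by rewrite -normrN fle.
Qed.

Lemma lin_functional_continuous : (forall y, f y <= `|y|) -> continuous f.
Proof.
move=> fle x; apply/cvgrPdist_le => e e0; near=> y.
rewrite -lin_functionalB; apply: le_trans (lin_functional_norm_le fle _) _.
near: y; apply: cvgr_dist_le e0; exact: cvg_id.
Unshelve. all: by end_near. Qed.

End Linear.

Lemma JsetP z f : z != 0 -> Jset z f <-> supports z f.
Proof.
move=> z0; split=> [[[lf cf] [nf fz]]|[lf fle fz]].
  split=> // y.
  (* [sup] defaults to 0 on a set without supremum, which norm one excludes. *)
  have hs : has_sup [set `|f x| | x in [set x : X | `|x| <= 1]].
    apply: contrapT => /sup_out; rewrite -/(fnorm f) nf => /eqP.
    by rewrite oner_eq0.
  have [->|y0] := eqVneq y 0; first by rewrite lin_functional0 // normr0.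
  have ny : 0 < `|y| by rewrite normr_gt0.
  have : `|f (`|y|^-1 *: y)| <= 1.
    rewrite -nf; apply: ub_le_sup; first by case: hs.
    exists (`|y|^-1 *: y) => //=.
    by rewrite normrZ normfV normr_id mulVf ?gt_eqF.
  rewrite (lin_functionalZ _ lf) normrM normfV normr_id ler_pdivrMl// mulr1.
  exact: le_trans (ler_norm _).
split; first by split=> //; exact: lin_functional_continuous.
split=> //; apply/eqP; rewrite eq_le; apply/andP; split.
  apply: ge_sup; first by exists `|f 0|, 0 => //=; rewrite normr0.
  by move=> _ [x /= x1 <-]; apply: le_trans x1; exact: lin_functional_norm_le.
apply: ub_le_sup.
  exists 1 => _ [x /= x1 <-]; apply: le_trans x1; exact: lin_functional_norm_le.
exists (`|z|^-1 *: z) => /=.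
  by rewrite normrZ normfV normr_id mulVf ?normr_eq0.
by rewrite (lin_functionalZ _ lf) fz mulVf ?normr_eq0// normr1.
Qed.

(** Hahn-Banach is applied to [norm_rderiv x], touching at [v]; the bound at [- x] forces [f] to
    attain the norm at [x]. *)
Lemma exists_supports_rderiv x v : exists f, supports x f /\ f v = norm_rderiv x v.
Proof.
have sD := descent_sublinear _ x norm_sublinear.
have [f [lf fle fv]] := hahn_banach_touching _ v sD.
exists f; split=> //; split=> // [y|].
  exact: le_trans (fle y) (descent_le_self _ _ _ norm_sublinear).
apply/eqP; rewrite eq_le.
rewrite (le_trans (fle x) (descent_le_self _ _ _ norm_sublinear))/=.
have := le_trans (fle (- x)) (descentN _ x norm_sublinear).
by rewrite (lin_functionalN _ lf) lerN2.
Qed.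

(** Uniqueness identifies [f] with the functional realising the derivative along [v]. *)
Lemma norm_rderiv_smooth x f v : smooth_pt x -> supports x f -> norm_rderiv x v = f v.
Proof.
move=> [x0 [g [_ gU]]] /(JsetP _ _ x0) /gU ->.
by have [h [/(JsetP _ _ x0) /gU -> ->]] := exists_supports_rderiv x v.
Qed.

Lemma supports_BJ_orth x f v : supports x f -> f v = 0 -> BJ_orth x v.
Proof.
move=> [lf fle fx] fv l; apply: le_trans (fle _).
by rewrite (lin_functionalD _ lf) (lin_functionalZ _ lf) fv fx mulr0 addr0.
Qed.

Lemma smooth_rho_orth x f v : smooth_pt x -> supports x f -> f v = 0 ->
  [/\ rho_plus_orth x v, rho_minus_orth x v & rho_orth x v].
Proof.
move=> sx sf fv.
have e1 : norm_rderiv x v = 0 by rewrite (norm_rderiv_smooth _ _ _ sx sf).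
have e2 : norm_rderiv x (- v) = 0.
  by case: (sf) => lf _ _; rewrite (norm_rderiv_smooth _ _ _ sx sf) (lin_functionalN _ lf) fv oppr0.
rewrite /rho_plus_orth /rho_minus_orth /rho_orth /rho rho_plusE rho_minusE e1 e2.
by split; rewrite !mulr0 ?oppr0 ?addr0 ?mul0r.
Qed.

End NormDerivative.

(** * Rigidity of operators sharing support functionals with the norm *)

Section NormRatio.
Context {R : realType} {X Y : normedModType R}.
Variable T : {linear X -> Y}.
Implicit Types (x y z u w b v : X) (f : X -> R).

(* |T x| / |x| *: f is a subgradient at x of the seminorm y |-> |T y|. *)
Definition ratio_supports x f : Prop :=
  supports x f /\ forall y, `|T x| * f y <= `|T y| * `|x|.

Lemma ratio_supports_of_BJ x f : x != 0 -> supports x f ->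
  (forall v, f v = 0 -> BJ_orth (T x) (T v)) -> ratio_supports x f.
Proof.
move=> x0 sf h; split=> // y; have [lf fle fx] := sf.
have [fy|fy] := leP (f y) 0.
  by apply: (@le_trans _ _ 0); rewrite ?mulr_ge0// mulr_ge0_le0.
have nx : 0 < `|x| by rewrite normr_gt0.
(* The component of [y] along [x] is [a *: x]; orthogonality to the remainder, tested at the scalar
   [a^-1], compares [T x] with [a^-1 *: T y]. *)
set a := f y / `|x|; have a0 : 0 < a by rewrite divr_gt0.
have /h/(_ a^-1) : f (y - a *: x) = 0.
  by rewrite (lin_functionalB _ lf) (lin_functionalZ _ lf) fx divfK ?gt_eqF// subrr.
rewrite linearB linearZ scalerBr scalerA mulVf ?gt_eqF// scale1r addrC subrK.
rewrite normrZ gtr0_norm ?invr_gt0// ler_pdivlMl// => ha.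
have -> : f y = a * `|x| by rewrite divfK ?gt_eqF.
by rewrite mulrCA mulrA ler_wpM2r.
Qed.

Variable M : R.
Hypothesis M0 : 0 <= M.
Hypothesis TM : forall x, `|T x| <= M * `|x|.

Let r x : R := `|T x| / `|x|.

(** This later exchanges the endpoints of the segment for nearby points of the dense set. *)
Lemma norm_ratio_lipschitz (m : R) u w : 0 < m -> m <= `|u| -> 0 < `|w| ->
  r u - r w <= M / m * (2 * `|u - w|).
Proof.
move=> m0 mu w0; have u0 : 0 < `|u| by exact: lt_le_trans mu.
have e1 : `|T u| <= `|T w| + M * `|u - w|.
  by have := ler_normD (T w) (T (u - w)); have := TM (u - w); rewrite -linearD subrKC; lra.
have e2 : `|w| <= `|u| + `|u - w|.
  by have := ler_normD u (w - u); rewrite subrKC distrC.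
have e3 := TM w; have rw0 : 0 <= r w by rewrite divr_ge0.
have rwM : r w <= M by rewrite ler_pdivrMr.
have rwE : `|T w| = r w * `|w| by rewrite divfK ?gt_eqF.
have d0 : 0 <= `|u - w| by [].
apply: (@le_trans _ _ (M * (2 * `|u - w|) / `|u|)).
  rewrite lerBlDr {1}/r ler_pdivrMr// mulrDl divfK ?gt_eqF//.
  have : r w * `|w| <= r w * (`|u| + `|u - w|) by rewrite ler_wpM2l.
  have : r w * `|u - w| <= M * `|u - w| by rewrite ler_wpM2r.
  nra.
rewrite mulrAC ler_wpM2r ?mulr_ge0// ler_wpM2l// lef_pV2 ?posrE//.
Qed.

(* The slopes f_i b are monotone along the segment up to the errors eps, so the
   deficits |z_(i+1)| - f_i z_(i+1) telescope. *)
Lemma norm_ratio_chain (n : nat) (z : nat -> X) (f : nat -> X -> R) b (m h eps : R) :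
  0 < m ->
  (forall i, (i <= n)%N -> ratio_supports (z i) (f i) /\ m <= `|z i|) ->
  (forall i, (i < n)%N -> `|z i.+1 - z i - h *: b| <= eps) ->
  r (z 0%N) - r (z n) <= M / m * (h * (f n b - f 0%N b) + n%:R * (2 * eps)).
Proof.
move=> m0; elim: n => [|n IH] hz hd; first by rewrite !subrr mulr0 mul0r addr0 mulr0.
have {}IH := IH (fun i hi => hz i (leqW hi)) (fun i hi => hd i (leqW hi)).
have [[[lf fle fz] fr] mz] := hz n (leqnSn n).
have [[[lg gle gz] gr] mw] := hz n.+1 (leqnn _).
have {hz hd} := hd n (ltnSn n).
move: (z n) (z n.+1) (f n) (f n.+1) lf fle fz fr mz lg gle gz gr mw IH.
move=> u w p q lp ple pu pr mu lq qle qw qr mw IH.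
set e := w - u - h *: b => he.
have u0 : 0 < `|u| by exact: lt_le_trans mu.
have w0 : 0 < `|w| by exact: lt_le_trans mw.
have wE : w = u + (h *: b + e) by rewrite /e !subrKC.
clearbody e.
(* The deficit is [q - p] at [w = u + (h *: b + e)]: the term at [u] is at most 0 because [p]
   supports [u], and [e] costs at most [2 * eps]. *)
have deficit : `|w| - p w <= h * (q b - p b) + 2 * eps.
  rewrite -qw {1 2}wE !(lin_functionalD _ lp, lin_functionalD _ lq,
    lin_functionalZ _ lp, lin_functionalZ _ lq) pu.
  have := qle u; have := qle e.
  have := ple (- e); rewrite (lin_functionalN _ lp) normrN; lra.
have pw : p w <= `|w| by [].
(* The subgradient inequality at [u], tested on [w], gives [r u * p w] at most the norm of [T w]. *)
have step : r u - r w <= M / m * (`|w| - p w).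
  have ru0 : 0 <= r u by rewrite divr_ge0.
  have ruM : r u <= M by rewrite ler_pdivrMr.
  have d0 : 0 <= `|w| - p w by rewrite subr_ge0.
  apply: (@le_trans _ _ (M * (`|w| - p w) / `|w|)).
    rewrite lerBlDr -lerBlDl [X in _ <= X]/r ler_pdivlMr// mulrBl divfK ?gt_eqF//.
    have : r u * p w <= `|T w|.
      by rewrite /r mulrAC ler_pdivrMr.
    have : r u * (`|w| - p w) <= M * (`|w| - p w) by rewrite ler_wpM2r.
    lra.
  by rewrite mulrAC ler_wpM2r ?mulr_ge0// ler_wpM2l// lef_pV2 ?posrE.
have Mm : 0 <= M / m by rewrite divr_ge0// ltW.
have : M / m * (`|w| - p w) <= M / m * (h * (q b - p b) + 2 * eps) by rewrite ler_wpM2l.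
rewrite -natr1; lra.
Qed.

End NormRatio.

(** By compactness the norm attains its minimum on the segment; a zero minimum makes [y] a multiple
    of [x], a case that homogeneity handles. *)
Lemma segment_norm_lower_bound {R : realType} {X : normedModType R} (x y : X) :
  x != 0 -> (exists c : R, y = c *: x) \/
  exists2 m : R, 0 < m & forall t : R, 0 <= t <= 1 -> m <= `|x + t *: (y - x)|.
Proof.
move=> x0.
have cF : continuous (fun t : R => `|x + t *: (y - x)|).
  move=> t; apply: cvg_norm; apply: cvgD; first exact: cvg_cst.
  by apply: cvgZr_tmp; exact: cvg_id.
have [c c01 cmin] := EVT_min ler01 (continuous_subspaceT cF).
have [c0|c0] := eqVneq (x + c *: (y - x)) 0; last first.
  right; exists `|x + c *: (y - x)|; first by rewrite normr_gt0.
  by move=> t t01; apply: cmin; rewrite in_itv.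
left; have cn0 : c != 0.
  by apply: contra_neq x0 => cE; rewrite -c0 cE scale0r addr0.
exists (c^-1 * (c - 1)); apply: (scalerI cn0).
rewrite [RHS]scalerA mulVKf// scalerBl scale1r; apply/eqP; rewrite -subr_eq0 -c0.
by rewrite scalerBr opprB addrC addrAC addrA.
Qed.

Section Rigidity.
Context {R : realType} {X Y : normedModType R}.
Variable T : {linear X -> Y}.

Lemma norm_ratio_le (D : set X) (M : R) : dense D ->
  (forall x, D x -> exists f, ratio_supports T x f) ->
  0 <= M -> (forall x, `|T x| <= M * `|x|) ->
  forall x y, `|T x| * `|y| <= `|T y| * `|x|.
Proof.
move=> dD hD M0 TM x y.
have [->|x0] := eqVneq x 0; first by rewrite linear0 !normr0 mul0r mulr0.
have [->|y0] := eqVneq y 0; first by rewrite linear0 !normr0 mul0r mulr0.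
have [[c ->]|[m m0 hm]] := segment_norm_lower_bound x y x0.
  by rewrite linearZ !normrZ mulrCA mulrA.
have nx : 0 < `|x| by rewrite normr_gt0.
have ny : 0 < `|y| by rewrite normr_gt0.
rewrite -ler_pdivrMr// mulrAC -ler_pdivlMr// leNgt; apply/negP => hlt.
set d := `|T x| / `|x| - `|T y| / `|y|.
have d0 : 0 < d by rewrite subr_gt0.
(* In units of [h], the slopes cost twice the norm of [b], the accumulated errors 4, and each of the
   two ends 2. *)
pose b := y - x; pose C := M / (m / 2) * (2 * `|b| + 8).
have m2 : 0 < m / 2 by rewrite divr_gt0.
have K0 : 0 <= M / (m / 2) by rewrite divr_ge0// ltW.
have C0 : 0 <= C by rewrite mulr_ge0// addr_ge0// mulr_ge0.
suff bound n : (0 < n)%N -> d <= C / n%:R.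
  have hn := archi_boundP (divr_ge0 C0 (ltW d0)).
  have n0 : (0 < Num.bound (C / d))%N.
    by rewrite -(ltr_nat R); apply: le_lt_trans hn; rewrite divr_ge0// ltW.
  move: hn; rewrite ltr_pdivrMr// mulrC -ltr_pdivrMr ?ltr0n// ltNge.
  by rewrite bound.
move=> n0; pose h : R := n%:R^-1.
have nR0 : 0 < n%:R :> R by rewrite ltr0n.
have h0 : 0 < h by rewrite invr_gt0.
have nh : n%:R * h = 1 by rewrite divff ?gt_eqF.
have h1 : h <= 1 by rewrite invf_le1// ler1n.
(* The bound [m / 2] keeps the perturbed points away from 0; [h * h] keeps the sum of [n] errors of
   order [h]. *)
pose eps := Num.min (m / 2) (h * h).
have e0 : 0 < eps by rewrite lt_min m2 mulr_gt0.
have em : eps <= m / 2 by rewrite ge_min lexx.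
have eh : eps <= h * h by rewrite ge_min lexx orbT.
pose s i := x + (i%:R * h) *: b.
have sS i : s i.+1 = s i + h *: b by rewrite /s -natr1 mulrDl mul1r scalerDl addrA.
have sx : s 0%N = x by rewrite /s mul0r scale0r addr0.
have sy : s n = y by rewrite /s nh scale1r subrKC.
have sm i : (i <= n)%N -> m <= `|s i|.
  move=> hi; apply: hm; apply/andP; split; first by rewrite mulr_ge0 ?(ltW h0).
  by rewrite -[leRHS]nh ler_wpM2r ?(ltW h0) ?ler_nat.
clearbody s.
have ex i : exists zf : X * (X -> R), ratio_supports T zf.1 zf.2 /\ `|s i - zf.1| < eps.
  have [||z [hz Dz]] := dD (ball (s i) eps); [|exact: ball_open|].
    by exists (s i); exact: ballxx.
  have [f hf] := hD _ Dz; exists (z, f); split=> //.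
  by move: hz; rewrite -ball_normE.
have [zf hzf] := choice ex.
pose z i := (zf i).1; pose f i := (zf i).2.
have hz i : `|s i - z i| <= eps by apply: ltW; exact: (hzf i).2.
have zm i : (i <= n)%N -> m / 2 <= `|z i|.
  move=> /sm; have := ler_normD (z i) (s i - z i); rewrite subrKC.
  have := hz i; lra.
(* Both endpoints of a step are perturbed, so the chain is run with error [2 * eps]. *)
have hd i : `|z i.+1 - z i - h *: b| <= 2 * eps.
  have -> : z i.+1 - z i - h *: b = (s i - z i) - (s i.+1 - z i.+1).
    by rewrite sS opprB [RHS]addrC opprD !addrA [X in _ = X - _](addrAC (z i.+1 - s i)) subrK addrAC.
  have := ler_normB (s i - z i) (s i.+1 - z i.+1).
  by have := hz i; have := hz i.+1; lra.
have [[_ flen _] _] : ratio_supports T (z n) (f n) := (hzf n).1.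
have [[lf0 fle0 _] _] : ratio_supports T (z 0%N) (f 0%N) := (hzf 0%N).1.
have chain := norm_ratio_chain T M M0 TM n z f b (m / 2) h (2 * eps) m2
  (fun i hi => conj (hzf i).1 (zm i hi)) (fun i _ => hd i).
have zn0 : 0 < `|z n| by apply: lt_le_trans (zm _ (leqnn n)).
have z00 : 0 < `|z 0%N| by apply: lt_le_trans (zm _ (leq0n n)).
have mx : m / 2 <= `|x| by have := sm 0%N (leq0n n); rewrite sx; lra.
have left_end := norm_ratio_lipschitz T M M0 TM (m / 2) x (z 0%N) m2 mx z00.
have right_end := norm_ratio_lipschitz T M M0 TM (m / 2) (z n) y m2 (zm _ (leqnn n)) ny.
have := hz 0%N; rewrite sx => hx.
have := hz n; rewrite sy distrC => hy.
have slopes : h * (f n b - f 0%N b) <= h * (2 * `|b|).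
  rewrite ler_wpM2l ?(ltW h0)//; have := flen b; have := fle0 (- b).
  by rewrite (lin_functionalN _ lf0) normrN; lra.
have ne : n%:R * (2 * (2 * eps)) <= 4 * h.
  have : n%:R * eps <= n%:R * (h * h) by rewrite ler_wpM2l ?(ltW nR0).
  rewrite mulrA nh; lra.
have hh : h * h <= h by rewrite ler_piMr// ltW.
rewrite /d -(subrKA (`|T (z 0%N)| / `|z 0%N|)) -(subrKA (`|T (z n)| / `|z n|) (`|T (z 0%N)| / `|z 0%N|)).
apply: le_trans (lerD left_end (lerD chain right_end)) _.
rewrite -!mulrDr -/h /C -mulrA; apply: ler_wpM2l => //; lra.
Qed.

Lemma continuous_linear_norm_le : continuous T ->
  exists2 M : R, 0 <= M & forall x, `|T x| <= M * `|x|.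
Proof.
move=> cT; have /linear_boundedP := continuous_linear_bounded 0 (cT 0).
by move=> /pinfty_ex_gt0[M M0 hM]; exists M => //; exact: ltW.
Qed.

End Rigidity.

(** * Orthogonality preservation and scalar multiples of isometries *)

Section Preservation.
Context {R : realType} {X : normedModType R}.
Variable T : {linear X -> X}.
Implicit Types (x y v : X) (f phi : X -> R).

(** Using [norm_ratio_le] in both orders makes the ratio constant; the zero space is treated
    apart. *)
Lemma scalar_mult_isometry_of_dense (D : set X) : continuous T -> dense D ->
  (forall x, D x -> exists f, ratio_supports T x f) -> scalar_mult_isometry T.
Proof.
move=> /continuous_linear_norm_le[M M0 TM] dD hD.
have rle := norm_ratio_le T D M dD hD M0 TM.
have [[x x0]|h] := pselect (exists x : X, x != 0); last first.
  exists 0 => x; have [->|x0] := eqVneq x 0; first by rewrite linear0 normr0 mul0r.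
  by case: h; exists x.
exists (`|T x| / `|x|) => y; have nx : `|x| != 0 by rewrite normr_eq0.
apply: (mulIf nx); rewrite [RHS]mulrAC divfK//.
by apply/eqP; rewrite eq_le !rle.
Qed.

Lemma scalar_mult_isometry_of_smooth : continuous T -> dense (@SmX R X) ->
  (forall x f v, smooth_pt x -> supports x f -> f v = 0 -> BJ_orth (T x) (T v)) ->
  scalar_mult_isometry T.
Proof.
move=> cT dS h; apply: (scalar_mult_isometry_of_dense _ cT dS) => x sx.
have [x0 [f [/(JsetP _ _ x0) sf _]]] := sx.
by exists f; apply: ratio_supports_of_BJ => // v; exact: h.
Qed.

Lemma scalar_mult_isometry_of_dense_BJ (U : set X) : continuous T -> dense U ->
  (forall x, U x -> preserves_at BJ_orth T x) -> scalar_mult_isometry T.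
Proof.
move=> cT dU h; apply: (scalar_mult_isometry_of_dense _ cT dU) => x /h hx.
have [f [sf _]] := exists_supports_rderiv x 0; exists f.
(* The dense set may contain 0, where the subgradient inequality is trivial. *)
have [x0|x0] := eqVneq x 0.
  by split=> // y; rewrite x0 linear0 !normr0 mul0r mulr0.
apply: ratio_supports_of_BJ => // v fv; apply: hx; exact: supports_BJ_orth sf fv.
Qed.

Lemma BJ_orthZl (a : R) x v : a != 0 -> BJ_orth (a *: x) v <-> BJ_orth x v.
Proof.
move=> a0; have na : 0 < `|a| by rewrite normr_gt0.
have E (l : R) : `|a *: x + l *: v| = `|a| * `|x + (a^-1 * l) *: v|.
  by rewrite -normrZ scalerDr scalerA mulVKf.
split=> h l; last by rewrite E normrZ ler_pM2l.
by have := h (a * l); rewrite E normrZ mulKf// ler_pM2l.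
Qed.

(** A kernel point leaves the kernel by an arbitrarily small non-zero multiple of [w]. *)
Lemma dense_non_kernel phi : dual_elt phi -> (exists x, phi x != 0) ->
  dense [set x | phi x != 0].
Proof.
move=> [lp _] [w pw] O [x Ox] oO.
have [px|px] := eqVneq (phi x) 0; last by exists x.
have cF : (x + t *: w) @[t --> (0 : R)^'] --> x.
  rewrite -[X in _ --> X]addr0 -(scale0r w); apply: cvgD; first exact: cvg_cst.
  by apply: cvgZr_tmp; apply: cvg_within_filter; exact: cvg_id.
have Onear : \forall t \near (0 : R)^', O (x + t *: w).
  by apply: cF; exact: open_nbhs_nbhs.
have [t [Ot t0]] : exists t : R, O (x + t *: w) /\ t != 0.
  near (0 : R)^' => t; exists t; split; first by near: t.
  by near: t; exact: nbhs_dnbhs_neq.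
exists (x + t *: w); split=> //=.
by rewrite (lin_functionalD _ lp) (lin_functionalZ _ lp) px add0r mulf_neq0.
Unshelve. all: by end_near. Qed.

Lemma preserves_BJ_off_kernel (H : set X) : affine_hyperplane H ->
  (forall x, H x -> preserves_at BJ_orth T x) ->
  exists U : set X, dense U /\ forall x, U x -> preserves_at BJ_orth T x.
Proof.
move=> [phi [c [dphi [phi0 [c0 ->]]]]] h; exists [set x | phi x != 0].
split; first exact: dense_non_kernel.
move=> x /= px v; have a0 : c / phi x != 0 by rewrite mulf_neq0 ?invr_eq0.
move=> /(BJ_orthZl _ _ _ a0) /h; rewrite linearZ => h'.
apply/(BJ_orthZl _ _ _ a0); apply: h' => /=.
by rewrite (lin_functionalZ _ dphi.1) divfK.
Qed.

Lemma exists_affine_hyperplane x f : x != 0 -> supports x f ->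
  exists H : set X, affine_hyperplane H.
Proof.
move=> x0 [lf fle fx]; exists [set y | f y = 1], f, 1; split.
  by split=> //; exact: lin_functional_continuous.
by split; [exists x; rewrite fx normr_eq0|split=> //; exact: oner_neq0].
Qed.

Lemma norm_rderiv_isometry (l : R) : (forall x, `|T x| = l * `|x|) ->
  forall x v, norm_rderiv (T x) (T v) = l * norm_rderiv x v.
Proof.
move=> hl x v; rewrite -(cvg_lim _ (cvg_norm_quotient_right (T x) (T v)))//.
have -> : (fun t : R => (`|T x + t *: T v| - `|T x|) / t) =
          (fun t : R => l * ((`|x + t *: v| - `|x|) / t)).
  by apply/funext => t; rewrite -linearZ -linearD !hl -mulrBr mulrA.
by apply/cvg_lim => //; apply: cvgMl_tmp; exact: cvg_norm_quotient_right.
Qed.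

Lemma isometry_preserves : scalar_mult_isometry T ->
  [/\ forall x, preserves_at BJ_orth T x,
      forall x, preserves_at rho_plus_orth T x,
      forall x, preserves_at rho_minus_orth T x &
      forall x, preserves_at rho_orth T x].
Proof.
move=> [l hl]; have rE := norm_rderiv_isometry l hl.
have plusE x v : rho_plus (T x) (T v) = l ^+ 2 * rho_plus x v.
  by rewrite !rho_plusE hl rE; ring.
have minusE x v : rho_minus (T x) (T v) = l ^+ 2 * rho_minus x v.
  by rewrite !rho_minusE hl -linearN rE; ring.
split=> x v h.
- move=> t; rewrite -linearZ -linearD !hl.
  have [l0|l0] := leP 0 l; first by rewrite ler_wpM2l.
  (* The factor in [scalar_mult_isometry] may be negative, but then every vector is zero. *)
  have n0 y : `|y| = 0 :> R.
    by apply/eqP; rewrite eq_le normr_ge0 andbT -(nmulr_rge0 _ l0) -hl.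
  by rewrite !n0.
- by rewrite /rho_plus_orth plusE h mulr0.
- by rewrite /rho_minus_orth minusE h mulr0.
- by rewrite /rho_orth /rho plusE minusE -mulrDr -mulrA (h : _ / 2 = 0) mulr0.
Qed.

End Preservation.

Theorem mainTheorem9 (R : realType) (X : completeNormedModType R)
  (hSm : dense (@SmX R X) /\ G_delta (@SmX R X))
  (T : {linear X -> X}) (hTc : continuous T) (hT0 : exists x : X, T x != 0) :
  [<-> (forall x, SmX x -> preserves_at BJ_orth T x);
       (exists U : set X, dense U /\ forall x, U x -> preserves_at BJ_orth T x);
       (exists H : set X, affine_hyperplane H /\ forall x, H x -> preserves_at BJ_orth T x);
       (forall x, SmX x -> preserves_at rho_plus_orth T x);
       (forall x, SmX x -> preserves_at rho_minus_orth T x);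
       (forall x, SmX x -> preserves_at rho_orth T x);
       scalar_mult_isometry T].
Proof.
have [dS _] := hSm.
have dense_iso : (exists U : set X, dense U /\ forall x, U x -> preserves_at BJ_orth T x) ->
    scalar_mult_isometry T.
  by move=> [U [dU hU]]; exact: scalar_mult_isometry_of_dense_BJ dU hU.
tfae.
- by move=> h; exists (@SmX R X).
- move=> /dense_iso /isometry_preserves[hBJ _ _ _].
  (* A scalar multiple of an isometry preserves orthogonality everywhere, so any hyperplane will do;
     [T] being non-zero provides one. *)
  have [x Tx] := hT0; have [f [sf _]] := exists_supports_rderiv x 0.
  have x0 : x != 0 by apply: contra_neq Tx => ->; rewrite linear0.
  by have [H hH] := exists_affine_hyperplane x f x0 sf; exists H.
- move=> [H [aH hH]].
  by have /dense_iso/isometry_preserves[_ hp _ _] := preserves_BJ_off_kernel T H aH hH.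
- move=> h x sx v /rho_plus_orthN /(h x sx).
  by rewrite linearN => /rho_plus_orthN.
- move=> h.
  have /isometry_preserves[] // : scalar_mult_isometry T.
  apply: scalar_mult_isometry_of_smooth => // x f v sx sf fv.
  have lf : lin_functional f by case: sf.
  (* Both [v] and [- v] lie in the kernel of [f]; applying the hypothesis to each makes both
     one-sided derivatives at [T x] vanish, up to the factor given by its norm. *)
  have [_ hm _] := smooth_rho_orth _ _ _ sx sf fv.
  have fNv : f (- v) = 0 by rewrite (lin_functionalN _ lf) fv oppr0.
  have [_ hn _] := smooth_rho_orth _ _ _ sx sf fNv.
  apply: BJ_orth_of_rho_plus; last by apply/rho_plus_orthN; exact: h hm.
  by rewrite -[T v]opprK; apply/rho_plus_orthN; rewrite -linearN; exact: h hn.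
- move=> h; apply: scalar_mult_isometry_of_smooth => // x f v sx sf fv.
  by have [_ _ hr] := smooth_rho_orth _ _ _ sx sf fv; apply: BJ_orth_of_rho; exact: h hr.
- by move=> /isometry_preserves[hBJ _ _ _] x _.
Qed.
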